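(* For every $n\ge2$, $$q(\mathcal{P}_n)>1\quad\Longleftrightarrow\quad x_ny_n\ \text{is not squarefree}.$$ In particular, $q(\mathcal{P}_{7j+4})>1$ for every integer $j\ge0$. More quantitatively, for every $j\ge0$, $$q(\mathcal{P}_{7j+4})-1>\frac{\log(13/\sqrt2)}{\log\bigl(2y_{7j+4}^2\bigr)}.$$ The progression $n\equiv4\pmod7$ therefore yields $$\liminf_{X\to\infty}\frac{\#\{n\le X:q(\mathcal{P}_n)>1\}}X\ \ge\ \frac17 .$$
   Context: Define sequences of positive integers by $(x_1,y_1)=(1,1)$, $x_{n+1}=3x_n+4y_n$, $y_{n+1}=2x_n+3y_n$; they satisfy $x_n^2-2y_n^2=-1$. For $n\ge2$ put $\mathcal{P}_n=(1,x_n^2,2y_n^2)$, so that the first two entries sum to the third. For a triple $(a,b,c)$ of positive integers with $a+b=c$, the quality is $q(a,b,c)=\log c/\log\mathrm{rad}(abc)$, where $\mathrm{rad}(n)$ is the product of the distinct primes dividing $n$. *)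

(* Defs.v *)
From HB Require Import structures.
From mathcomp Require Import all_boot all_order all_algebra.
From mathcomp Require Import all_classical all_reals all_analysis.
From mathcomp Require Import zify.

Set Implicit Arguments.
Unset Strict Implicit.
Unset Printing Implicit Defensive.

Import Order.TTheory GRing.Theory Num.Theory.

(* The sequences start at index 1; index 0 carries the junk value (1, 1). *)
Definition pell (n : nat) : nat * nat :=
  iter n.-1 (fun p => (3 * p.1 + 4 * p.2, 2 * p.1 + 3 * p.2)) (1, 1).

Definition pell_x (n : nat) : nat := (pell n).1.
Definition pell_y (n : nat) : nat := (pell n).2.

Definition pell_triple (n : nat) : nat * nat * nat :=
  (1, pell_x n ^ 2, 2 * pell_y n ^ 2).

Lemma pell_xS (n : nat) : 0 < n ->
  pell_x n.+1 = 3 * pell_x n + 4 * pell_y n.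
Proof. by case: n. Qed.

Lemma pell_yS (n : nat) : 0 < n ->
  pell_y n.+1 = 2 * pell_x n + 3 * pell_y n.
Proof. by case: n. Qed.

Lemma pell_tripleE (n : nat) :
  let: (a, b, c) := pell_triple n in a + b = c.
Proof.
rewrite /pell_triple; case: n => [//|n]; elim: n => [//|n IHn].
rewrite (@pell_xS n.+1)// (@pell_yS n.+1)//.
move: (pell_x _) (pell_y _) IHn => x y; rewrite !expnS !expn0; lia.
Qed.

(* [primes n] lists each prime divisor once. *)
Definition radical (n : nat) : nat := \prod_(p <- primes n) p.

Definition squarefree (n : nat) : Prop := forall d : nat, d ^ 2 %| n -> d = 1.

Definition quality {R : realType} (t : nat * nat * nat) : R :=
  let: (a, b, c) := t in (ln c%:R / ln (radical (a * b * c))%:R)%R.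

(* For a real X >= 0, the ordinals below [(truncn X).+1] are the n <= X. *)
Definition count_upto {R : realType} (P : nat -> bool) (X : R) : nat :=
  #|[set n : 'I_(Num.truncn X).+1 | P n]|.

(* Main.v *)
Require Import Defs.
From HB Require Import structures.
From mathcomp Require Import all_boot all_order all_algebra.
From mathcomp Require Import all_classical all_reals all_analysis.
From mathcomp Require Import zify lra.

Import Order.TTheory GRing.Theory Num.Theory.
Import numFieldNormedType.Exports.

(** Write r for the radical of x_n^2 * 2 y_n^2, which is also the radical of
    2 x_n y_n.  Since x_n^2 + 1 = 2 y_n^2, the number 2 x_n y_n lies between
    c = 2 y_n^2 and sqrt 2 * c: exceeding quality 1 means r < c, so the
    question is whether r is 2 x_n y_n itself or loses a factor of it.

    If x_n y_n is squarefree, then so is 2 x_n y_n because x_n and y_n are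
    odd, hence r = 2 x_n y_n >= c and the quality is at most 1.  If instead a
    prime p satisfies p^2 | x_n y_n, then p * r divides 2 x_n y_n
    ([dvdn_prime_mul_radical]), and x_n < sqrt 2 * y_n gives
    (p / sqrt 2) * r < c.  As ln r < ln c, this yields
    q - 1 = ln (c / r) / ln r > ln (p / sqrt 2) / ln c ([quality_pell_gt]),
    a positive bound because p >= 2.  The equivalence ([quality_pell_gt1])
    and the quantitative estimate both come from this dichotomy, the latter
    with p = 13: one has y_4 = 13^2, and seven steps of the recurrence send
    y to -y modulo 13^2, so 13^2 divides y_n along n = 7 j + 4
    ([dvdn_13_2_pell_y]).  A set containing an arithmetic progression of
    difference a has lower density at least 1 / a
    ([lower_density_progression]), whence the last claim. *)

(** * Radicals and squarefree numbers *)

Lemma prod_primes_logn n : 0 < n -> \prod_(p <- primes n) p ^ logn p n = n.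
Proof.
by move=> n_gt0; rewrite [RHS]prod_prime_decomp// prime_decompE big_map.
Qed.

Lemma eq_radical m n : primes m =i primes n -> radical m = radical n.
Proof. by rewrite /radical => /eq_primes ->. Qed.

(** Comparing n = \prod q ^ logn q n with its radical \prod q factor by factor:
    at p the exponent of n is at least 2, leaving room for one more p. *)
Lemma dvdn_prime_mul_radical p n : 0 < n -> prime p -> p ^ 2 %| n ->
  p * radical n %| n.
Proof.
move=> n_gt0 p_pr p2n.
have pn : p \in primes n.
  by rewrite mem_primes p_pr n_gt0 (dvdn_trans _ p2n)// expnS dvdn_mulr.
rewrite -[X in _ %| X]prod_primes_logn// /radical.
rewrite !(bigD1_seq p) ?primes_uniq//=.
rewrite mulnA dvdn_mul//.
  by rewrite -[p * p]/(p ^ 2) dvdn_exp2l// -pfactor_dvdn.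
rewrite !(big_seq_cond (fun q => q != p)).
elim/big_ind2: _ => // [a b c d|q /andP[qn _]]; first exact: dvdn_mul.
by rewrite -{1}[q]expn1 dvdn_exp2l// logn_gt0.
Qed.

Lemma radical_squarefree n : 0 < n -> squarefree n -> radical n = n.
Proof.
move=> n_gt0 sqf; rewrite -[RHS]prod_primes_logn//.
apply: eq_big_seq => p pn.
have p_pr : prime p by have:= pn; rewrite mem_primes => /andP[].
suff -> : logn p n = 1 by rewrite expn1.
apply/eqP; rewrite eqn_leq logn_gt0 pn andbT leqNgt -pfactor_dvdn//.
by apply/negP => /sqf p1; rewrite p1 in p_pr.
Qed.

Lemma radical_gt1 n : 1 < n -> 1 < radical n.
Proof.
move=> n_gt1; rewrite /radical (bigD1_seq (pdiv n)) ?primes_uniq//=; last first.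
  by rewrite mem_primes pdiv_prime// pdiv_dvd ltnW.
apply: leq_trans (prime_gt1 (pdiv_prime n_gt1)) _; rewrite leq_pmulr//.
rewrite big_seq_cond; apply: prodn_cond_gt0 => p /andP[].
by rewrite mem_primes => /andP[/prime_gt0].
Qed.

Lemma not_squarefreeP n :
  ~ squarefree n <-> exists2 p, prime p & p ^ 2 %| n.
Proof.
split=> [|[p p_pr p2n] sqf]; last by rewrite (sqf p p2n) in p_pr.
move=> /existsNP[[|d] /not_implyP[d2n d_neq1]].
  (* [0 ^ 2 %| n] forces [n = 0], which every prime square divides. *)
  by exists 2 => //; move: d2n; rewrite dvd0n => /eqP ->.
exists (pdiv d.+1); first by apply: pdiv_prime; lia.
by apply: dvdn_trans d2n; rewrite dvdn_exp2r// pdiv_dvd.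
Qed.

Lemma squarefree_double m : odd m -> squarefree m -> squarefree (2 * m).
Proof.
move=> m_odd sqf d d2; case: (boolP (odd d)) => d_odd.
  apply: sqf; rewrite -(Gauss_dvdr _ (m := d ^ 2) (n := 2))//.
  by rewrite coprimen2 oddX d_odd orbT.
have : 2 ^ 2 %| 2 * m by apply: dvdn_trans d2; rewrite dvdn_exp2r// dvdn2.
by rewrite dvdn_pmul2l// dvdn2 m_odd.
Qed.

(** * Arithmetic of the Pell sequences *)

Lemma pell_equation n : pell_x n ^ 2 + 1 = 2 * pell_y n ^ 2.
Proof. by rewrite addnC; exact: pell_tripleE. Qed.

Lemma odd_pell_x n : odd (pell_x n).
Proof.
have := congr1 odd (pell_equation n).
by rewrite oddD oddX /= oddM /=; case: (odd _).
Qed.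

Lemma odd_pell_y n : odd (pell_y n).
Proof.
case: n => [//|n]; elim: n => [//|n IH].
by rewrite pell_yS// oddD !oddM /= IH.
Qed.

(** The seventh power of the step matrix has second row
    (80782, 114243) = (169 * 478, 169 * 676 - 1), so seven steps negate y
    modulo y_4 = 169. *)
Lemma pell_y_add7 n : 0 < n ->
  pell_y (n + 7) + pell_y n = 169 * (478 * pell_x n + 676 * pell_y n).
Proof.
move=> n_gt0; rewrite !addnS addn0 !(pell_yS, pell_xS)//.
by move: (pell_x n) (pell_y n) => x y; lia.
Qed.

Lemma dvdn_13_2_pell_y j : 13 ^ 2 %| pell_y (7 * j + 4).
Proof.
elim: j => [//|j IH].
have -> : 7 * j.+1 + 4 = 7 * j + 4 + 7 by lia.
by rewrite -(dvdn_addl _ IH) pell_y_add7 ?dvdn_mulr// addn_gt0 orbT.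
Qed.

(** The radical only sees which primes occur, so the squares in the triple
    can be dropped. *)
Lemma radical_pell n :
  radical (1 * pell_x n ^ 2 * (2 * pell_y n ^ 2))
  = radical (2 * (pell_x n * pell_y n)).
Proof.
have x_gt0 := odd_gt0 (odd_pell_x n).
have y_gt0 := odd_gt0 (odd_pell_y n).
apply: eq_radical => p.
rewrite mul1n !(primesM, primesX, muln_gt0, expn_gt0, x_gt0, y_gt0)//.
by rewrite orbCA.
Qed.

(** * Quality of the Pell triples *)

Local Open Scope ring_scope.

Lemma quality_pellE (R : realType) n :
  quality (pell_triple n) =
  ln (2 * (pell_y n)%:R ^+ 2)
    / ln (radical (2 * (pell_x n * pell_y n)))%:R :> R.
Proof. by rewrite /quality /pell_triple radical_pell natrM natrX. Qed.

(** A square p^2 dividing x_n y_n costs the radical a factor p, of which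
    x_n / y_n < sqrt 2 gives back less than sqrt 2. *)
Lemma quality_pell_gt (R : realType) n p :
  prime p -> (p ^ 2 %| pell_x n * pell_y n)%N ->
  ln (p%:R / Num.sqrt 2) / ln (2 * (pell_y n)%:R ^+ 2)
    < quality (pell_triple n) - 1 :> R.
Proof.
move=> p_pr p2xy; rewrite quality_pellE.
have x_gt0 := odd_gt0 (odd_pell_x n); have y_gt0 := odd_gt0 (odd_pell_y n).
have xy_gt0 : (0 < 2 * (pell_x n * pell_y n))%N by rewrite !muln_gt0 x_gt0.
have r_gt1 : (1 < radical (2 * (pell_x n * pell_y n)))%N.
  by apply: radical_gt1; rewrite (leq_pmulr 2)// muln_gt0 x_gt0.
have pr_le : (p * radical (2 * (pell_x n * pell_y n)) <=
    2 * (pell_x n * pell_y n))%N.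
  by rewrite dvdn_leq// dvdn_prime_mul_radical// dvdn_mull.
have E : (pell_x n)%:R ^+ 2 + 1 = 2 * (pell_y n)%:R ^+ 2 :> R.
  by rewrite -!natrX -natrM -pell_equation natrD.
have : 2 <= p%:R :> R by rewrite ler_nat prime_gt1.
move: pr_le r_gt1 x_gt0 y_gt0.
rewrite -(ler_nat R) -!(ltr_nat R) !natrM.
(* What remains is about real numbers with [p * r <= 2 * (x * y)]. *)
move: p%:R (pell_x n)%:R (pell_y n)%:R (radical _)%:R E.
move=> {p_pr p2xy xy_gt0} p x y r E pr r1 x0 y0 p2.
set s : R := Num.sqrt 2.
have s0 : 0 < s by rewrite sqrtr_gt0.
have s2 : s ^+ 2 = 2 by rewrite sqr_sqrtr.
have x_lt : x < s * y.
  rewrite -(ltr_pXn2r (n := 2)) ?nnegrE ?mulr_ge0//; try exact: ltW.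
  by rewrite exprMn s2 -E ltrDl.
have ps_gt1 : 1 < p / s.
  by rewrite ltr_pdivlMr// mul1r; nra.
have psr_lt : p / s * r < 2 * y ^+ 2.
  rewrite mulrAC ltr_pdivrMr//; nra.
have c_pos : 0 < 2 * y ^+ 2 by nra.
have lnr0 : 0 < ln r by rewrite ln_gt0.
have r_lt : ln r < ln (2 * y ^+ 2) by rewrite ltr_ln ?posrE//; nra.
have t0 : 0 < ln (p / s) by rewrite ln_gt0.
have ln_lt : ln (p / s) + ln r < ln (2 * y ^+ 2).
  by rewrite -lnM ?ltr_ln ?posrE//; nra.
rewrite ltrBrDr ltr_pdivlMr// mulrDl mul1r.
apply: le_lt_trans ln_lt; rewrite lerD2r mulrAC ler_pdivrMr ?(lt_trans lnr0)//.
by rewrite ler_pM2l// ltW.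
Qed.

(** When x_n y_n is squarefree the radical is 2 x_n y_n, and x_n >= y_n keeps
    it at least 2 y_n^2; otherwise [quality_pell_gt] applies, its lower bound
    being nonnegative since p >= 2 > sqrt 2. *)
Lemma quality_pell_gt1 (R : realType) n :
  1 < quality (pell_triple n) :> R <-> ~ squarefree (pell_x n * pell_y n)%N.
Proof.
have x_gt0 := odd_gt0 (odd_pell_x n); have y_gt0 := odd_gt0 (odd_pell_y n).
split=> [+ sqf|/not_squarefreeP[p p_pr p2]]; last first.
  rewrite -subr_gt0; apply: le_lt_trans (quality_pell_gt R _ _ p_pr p2).
  have p_ge2 : 2 <= p%:R :> R by rewrite ler_nat prime_gt1.
  have c_ge1 : 1 <= 2 * (pell_y n)%:R ^+ 2 :> R.
    by rewrite -natrX -natrM ler1n muln_gt0 expn_gt0 y_gt0.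
  rewrite divr_ge0 ?ln_ge0// ler_pdivlMr ?sqrtr_gt0// mul1r.
  rewrite -[leRHS]ger0_norm// -sqrtr_sqr ler_sqrt; nra.
have r_gt1 : (1 < 2 * (pell_x n * pell_y n))%N.
  by rewrite (leq_pmulr 2)// muln_gt0 x_gt0.
rewrite quality_pellE radical_squarefree//; last first.
- by apply: squarefree_double; rewrite ?oddM ?odd_pell_x ?odd_pell_y.
- exact: ltnW.
rewrite ltr_pdivlMr ?ln_gt0 ?ltr1n// mul1r.
rewrite -natrX -natrM ltr_ln ?posrE ?ltr0n ?muln_gt0 ?expn_gt0 ?x_gt0 ?y_gt0//.
rewrite ltr_nat => xy_lt; have := pell_equation n; nia.
Qed.

(** * Lower density of an arithmetic progression *)

Lemma leq_count_upto (R : realType) (P : nat -> bool) (f : nat -> nat) k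
    (X : R) :
  injective f ->
  (forall j, (j < k)%N -> P (f j) && (f j <= Num.truncn X)%N) ->
  (k <= count_upto P X)%N.
Proof.
move=> f_inj fP; rewrite /count_upto.
pose g (j : 'I_k) : 'I_(Num.truncn X).+1 := inord (f j).
have gE j : g j = f j :> nat.
  by rewrite inordK// ltnS; case/andP: (fP j (ltn_ord j)).
have g_inj : injective g.
  move=> i j /(congr1 (@nat_of_ord _)); rewrite !gE => /f_inj ij.
  exact: val_inj.
rewrite -[leqLHS]card_ord -(card_imset _ g_inj) subset_leq_card//.
apply/fintype.subsetP => _ /imsetP[j _ ->]; rewrite inE gE.
by case/andP: (fP j (ltn_ord j)).
Qed.

Lemma le_limf_einf (R : realType) (T : choiceType) (X : filteredType T)
    (f : X -> \bar R) (F : set_system X) (l : R) :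
  (forall e : R, 0 < e -> \forall x \near F, ((l - e)%:E <= f x)%E) ->
  (l%:E <= limf_einf f F)%E.
Proof.
move=> lf; rewrite limf_einfE; apply/lee_subgt0Pr => e e0.
apply: le_trans (ereal_sup_ubound _); last first.
  by exists [set x | ((l - e)%:E <= f x)%E]%classic; first exact: lf.
by apply: le_ereal_inf_tmp => _ [x ? <-].
Qed.

(** About (N - b) / a terms of the progression are at most N = truncn X,
    so the proportion up to X is at least 1 / a - (a + b) / (a * X). *)
Lemma lower_density_progression (R : realType) (P : nat -> bool) a b :
  (0 < a)%N -> (forall j, P (a * j + b)%N) ->
  ((a%:R^-1 : R)%:E <= limf_einf (fun X : R => ((count_upto P X)%:R / X)%:E)
    (pinfty_nbhs R))%E.
Proof.
move=> a0 Pab; apply: le_limf_einf => e e0.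
near=> X.
have X0 : 0 < X by near: X; apply: nbhs_pinfty_gt; rewrite num_real.
(* Beyond this threshold the error [(a + b) / (a * X)] is at most [e]. *)
have XE : (a + b)%:R / (a%:R * e) <= X.
  by near: X; apply: nbhs_pinfty_ge; rewrite num_real.
(* Rounding down keeps every [a * j + b] with [j < k] at most [N]. *)
set N := Num.truncn X; pose k := ((N.+1 - b) %/ a)%N.
have k_le : (k <= count_upto P X)%N.
  apply: (@leq_count_upto R P (fun j => a * j + b)%N) => [i j|j jk].
    by move=> /addIn/eqP; rewrite eqn_pmul2l// => /eqP.
  rewrite Pab /= -/N.
  have := leq_divM (N.+1 - b) a; rewrite -/k; nia.
have X_lt : X < N.+1%:R := truncnS_gt X.
have N_le : (N.+1 <= a * k + (a + b))%N.
  have := ltn_ceil (N.+1 - b) a0; rewrite -/k; nia.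
rewrite lee_fin ler_pdivlMr//.
apply: le_trans (_ : k%:R <= _); last by rewrite ler_nat.
move: N_le; rewrite -(ler_nat R) natrD natrM => N_le.
have a0' : 0 < a%:R :> R by rewrite ltr0n.
rewrite -(ler_pM2l a0') mulrA mulrBr mulfV ?gt_eqF//.
move: XE; rewrite ler_pdivrMr ?mulr_gt0//.
lra.
Unshelve. all: by end_near.
Qed.

Theorem theorem4p31 (R : realType) :
  [/\ forall n : nat, (2 <= n)%N ->
        1 < quality (pell_triple n) :> R <->
          ~ squarefree (pell_x n * pell_y n),
      forall j : nat, 1 < quality (pell_triple (7 * j + 4)) :> R,
      forall j : nat,
        ln (13 / Num.sqrt 2) / ln (2 * (pell_y (7 * j + 4))%:R ^+ 2)
          < quality (pell_triple (7 * j + 4)) - 1 :> R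
    & (((1 / 7 : R)%:E) <=
        limf_einf (fun X : R =>
          ((count_upto (fun n => (2 <= n)%N &&
               (1 < quality (pell_triple n) :> R)) X)%:R / X)%:E)
          (pinfty_nbhs R))%E ].
Proof.
have q_gt1 j : 1 < quality (pell_triple (7 * j + 4)) :> R.
  apply/quality_pell_gt1/not_squarefreeP; exists 13%N => //.
  exact/dvdn_mull/dvdn_13_2_pell_y.
split=> [n _|//|j|]; first exact: quality_pell_gt1.
  exact/quality_pell_gt/dvdn_mull/dvdn_13_2_pell_y.
rewrite div1r; apply: (@lower_density_progression R _ 7 4) => // j.
by rewrite q_gt1 andbT addnC.
Qed.
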